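(* If $(G,\gamma)$ is an edge-colored graph with $\ell\geq 2$ colors $c_1,\dots,c_\ell$, then \[\operatorname{wld}(G)\geq\left\lceil \frac{\sum_{i=1}^{\ell}(\kappa(G_i)-1)}{\ell-1}\right\rceil.\]
   Context: An edge-colored graph $(G,\gamma)$ is a finite connected graph $G$ with a surjective function $\gamma:E(G)\to\mathcal{C}=\{c_1,\dots,c_\ell\}$ onto a finite set of colors (not necessarily a proper edge-coloring). For each color $c_i$ let $E_i(G)=\{e\in E(G):\gamma(e)=c_i\}$ and let $G_i$ be the graph with vertex set $V(G)$ and edge set $E_i(G)$; $\kappa(G_i)$ is its number of connected components. For $W\subseteq E(G)$, let $G_i^W$ be the graph with vertex set $V(G)$ and edge set $W\cup E_i(G)$. The set $W$ is color-connecting if $G_i^W$ is connected for every color $c_i\in\mathcal{C}$. The wild number $\operatorname{wld}(G)$ is the minimum size of a color-connecting set. *)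

(* Defs.v *)
From HB Require Import structures.
From mathcomp Require Import all_boot all_order all_algebra.

Set Implicit Arguments.
Unset Strict Implicit.
Unset Printing Implicit Defensive.

(* Finite undirected graphs. The edges form an abstract finite type, so that   *)
(* parallel edges are permitted; an edge with a single end is a loop. A simple *)
(* graph is one where [gends] is injective with values of cardinal 2.          *)
Record graph := Graph {
  gvert : finType;
  gedge : finType;
  gends : gedge -> {set gvert};
  gendsP : forall e, 0 < #|gends e| <= 2
}.

Section Subgraphs.
Variable G : graph.
Implicit Types (S : {set gedge G}) (x y : gvert G).

(* A set S of edges stands for the spanning subgraph (V(G), S). *)
Definition adj S : rel (gvert G) :=
  [rel x y | [exists e in S, gends e == [set x; y]]].

Lemma adj_sym S : symmetric (adj S).
Proof. by move=> x y /=; apply: eq_existsb => e; rewrite setUC. Qed.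

Lemma connect_adj_sym S : connect_sym (adj S).
Proof. exact/sym_connect_sym/adj_sym. Qed.

Definition kappa S : nat := n_comp (adj S) (gvert G).

Definition connected S : bool :=
  (0 < #|gvert G|) && [forall x, forall y, connect (adj S) x y].

End Subgraphs.

Record ecgraph (C : finType) := ECGraph {
  ec_graph :> graph;
  ec_conn : connected [set: gedge ec_graph];
  color : gedge ec_graph -> C;
  color_surj : forall c : C, exists e, color e = c
}.

Section WildNumber.
Variables (C : finType) (G : ecgraph C).
Implicit Types (c : C) (W : {set gedge G}).

Definition color_class c : {set gedge G} := [set e | color e == c].

Definition color_connecting W : bool :=
  [forall c, connected (W :|: color_class c)].

(* The default value [set: gedge G] is itself color-connecting (see           *)
(* [color_connectingT]), hence the minimum is attained; see [wldP].           *)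
Definition wld : nat :=
  #|[arg min_(W < [set: gedge G] | color_connecting W) #|W|]|.

Lemma color_connectingT : color_connecting [set: gedge G].
Proof. by apply/forallP => c; rewrite setTU ec_conn. Qed.

Lemma wldP :
  (exists2 W, color_connecting W & #|W| = wld) /\
  (forall W, color_connecting W -> wld <= #|W|).
Proof.
rewrite /wld; case: arg_minnP => [|W ccW minW]; first exact: color_connectingT.
by split=> //; exists W.
Qed.

End WildNumber.

(* Main.v *)
(* A color-connecting set W has to merge the components of each G_i, and an
   edge merges at most two of them, so kappa(G_i) - 1 <= #|W :\: E_i|. Each
   edge of W lies in W :\: E_i for all colors i but its own, so summing over
   the colors gives (l - 1) #|W| on the right. *)
Require Import Defs.
From mathcomp Require Import all_boot all_order all_algebra.

Import Order.TTheory GRing.Theory Num.Theory.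
Local Open Scope ring_scope.

Lemma gends_set2 {G : graph} (e : gedge G) :
  exists x y, gends e = [set x; y].
Proof.
have /andP[gt0 le2] := gendsP e.
have [/cards1P[x ->]|ne1] := boolP (#|gends e| == 1%N).
  by exists x, x; rewrite setUid.
have /cards2P[x [y [_ ->]]] : #|gends e| == 2%N.
  by rewrite eqn_leq le2 ltn_neqAle eq_sym ne1 gt0.
by exists x, y.
Qed.

Lemma connected_kappa {G : graph} (S : {set gedge G}) :
  connected S -> kappa S = 1%N.
Proof.
case/andP=> /card_gt0P[x _] /forallP conn.
rewrite -(n_comp_connect (connect_adj_sym S) x); apply: eq_n_comp_r => y.
by rewrite !inE; apply/esym/(forallP (conn x)).
Qed.

(** The new edge can only join the components of its two ends [x] and [y], so the roots for [S]
    other than that of [x] still lie in distinct components. *)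
Lemma leq_kappa_setU1 {G : graph} (e : gedge G) (S : {set gedge G}) :
  (kappa S <= (kappa (e |: S)).+1)%N.
Proof.
have [x [y ends_e]] := gends_set2 e.
set S' := e |: S; have symS := connect_adj_sym S.
have symS' := connect_adj_sym S'.
(* Relabels the component of [x] by the root of [y], which makes the label invariant along the edges
   of [S']. *)
pose merge u :=
  if fingraph.root (adj S) u == fingraph.root (adj S) x
  then fingraph.root (adj S) y else fingraph.root (adj S) u.
have merge_adj u v : adj S' u v -> merge u = merge v.
  case/existsP=> f /andP[]; rewrite !inE => /orP[/eqP->|Sf] /eqP ends_f.
    have: (u \in [set x; y]) && (v \in [set x; y]).
      by rewrite -ends_e ends_f !inE !eqxx orbT.
    (* Both [x] and [y] carry the label [root y], whether or not [S] already connects them. *)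
    rewrite !inE /merge.
    by case/andP=> /orP[]/eqP-> /orP[]/eqP->; rewrite ?eqxx //; case: ifP.
  suff uv : connect (adj S) u v by rewrite /merge (fingraph.rootP symS uv).
  by apply/connect1/existsP; exists f; rewrite Sf ends_f eqxx.
have merge_connect u v : connect (adj S') u v -> merge u = merge v.
  pose a := [pred w | merge u == merge w].
  have cl_a : closed (adj S') a by move=> w z /merge_adj; rewrite !inE => ->.
  by move/(closed_connect cl_a); rewrite !inE eqxx => /esym/eqP.
(* Away from the component of x, [merge] fixes the representatives of the
   components of S, so distinct ones stay disconnected in S'. *)
pose A := [set r | roots (adj S) r] :\ fingraph.root (adj S) x.
have inj_root : {in A &, injective (fingraph.root (adj S'))}.
  have mergeA r : r \in A -> merge r = r.
    by rewrite !inE /merge => /andP[r_x /eqP ->]; rewrite (negPf r_x).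
  move=> r s Ar As /(fingraph.rootP symS')/merge_connect.
  by rewrite !mergeA.
have kappaE (T : {set gedge G}) : kappa T = #|[set r | roots (adj T) r]|.
  by rewrite cardsE; apply: eq_card => r; rewrite !inE andbT.
(* The root of [x], left out of [A], accounts for the successor. *)
rewrite !kappaE (cardsD1 (fingraph.root (adj S) x)) inE roots_root //= ltnS.
rewrite -(card_in_imset inj_root); apply/subset_leq_card/subsetP => r.
by case/imsetP=> u _ ->; rewrite inE roots_root.
Qed.

(** The edges of [W] are added one at a time, each costing at most one component. *)
Lemma leq_kappa_setU {G : graph} (S W : {set gedge G}) :
  (kappa S <= kappa (W :|: S) + #|W|)%N.
Proof.
have [n] := ubnP #|W|; elim: n W => // n IH W.
have [->|[e We]] := set_0Vmem W; first by rewrite set0U cards0 addn0.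
rewrite (cardsD1 e) We ltnS => /IH leW; apply: leq_trans leW _.
rewrite addnA addn1 leq_add2r -[in leqRHS](setD1K We) -setUA.
exact: leq_kappa_setU1.
Qed.

Theorem proposition5p4 (C : finType) (G : ecgraph C) (hC : (2 <= #|C|)%N) :
  ((wld G)%:Z >=
   Num.ceil ((\sum_(c : C) ((kappa (color_class G c))%:R - 1)) /
             (#|C|%:R - 1) : rat)).
Proof.
have [[W /forallP ccW <-] _] := wldP G.
have kappa_leq c : (kappa (color_class G c) <= #|W :\: color_class G c|.+1)%N.
  have /connected_kappa kappa1 := ccW c.
  (* Removing the edges of color [c] from [W] leaves its union with the class unchanged; counting
     all of [W] here would only give the divisor [#|C|]. *)
  have := leq_kappa_setU (color_class G c) (W :\: color_class G c).
  by rewrite {1}setDE setUIl [~: _ :|: _]setUC setUCr setIT kappa1 add1n.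
have sumW : (\sum_(c : C) #|W :\: color_class G c| = #|W| * #|C|.-1)%N.
  transitivity (\sum_(c : C) \sum_(e in W | color e != c) 1)%N.
    apply: eq_bigr => c _; rewrite -sum1_card; apply: eq_bigl => e.
    by rewrite !inE andbC.
  rewrite (exchange_big_dep (mem W)) /=; last by move=> c e _ /andP[].
  rewrite -sum_nat_const; apply: eq_bigr => e We.
  rewrite -(cardC1 (color e)) -sum1_card; apply: eq_bigl => c.
  by rewrite We !inE eq_sym.
have C1 : 0 < #|C|%:R - 1 :> rat by rewrite subr_gt0 ltr1n.
(* As [#|W|] is an integer, it bounds the ceiling once it bounds the quotient. *)
rewrite ceil_le_int ler_pdivrMr //.
have -> : (#|W|%:Z)%:~R * (#|C|%:R - 1) = (#|W| * #|C|.-1)%:R :> rat.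
  by rewrite natrM -subn1 natrB // ltnW.
rewrite -sumW natr_sum; apply: ler_sum => c _.
by rewrite lerBlDr natr1 ler_nat.
Qed.
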